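(* Let $\mathcal{E}$ be an evolution algebra over $\mathbb{F}$ with $\mathcal{E}^2=\mathcal{E}$. Let $B$ be a natural basis and let $\Gamma=\Gamma(\mathcal{E},B)$ be the attached graph. Then: (1) If the characteristic of $\mathbb{F}$ is $0$ or $2$, then $\mathrm{Der}(\mathcal{E})=0$. (2) If the characteristic of $\mathbb{F}$ is $p\neq 0,2$, then $\mathrm{Der}(\mathcal{E})$ is an abelian Lie algebra whose dimension is the number of connected components $\Gamma_i$ of $\Gamma$ such that the (multiplicative) order of $2$ in $\mathbb{Z}/p\mathbb{Z}$ divides the balance $\mathrm{b}(\Gamma_i)$.
   Context: $\mathbb{F}$ is a field of arbitrary characteristic; all algebras are finite dimensional. An algebra is a vector space with a bilinear multiplication (not assumed associative, commutative or unital). An evolution algebra is an algebra $\mathcal{E}$ endowed with a basis $B=\{v_1,\ldots,v_n\}$ (a natural basis) such that $v_iv_j=0$ for all $i\neq j$. Write $v_i^2=\sum_{j=1}^n\alpha_{ij}v_j$ with $\alpha_{ij}\in\mathbb{F}$. $\mathcal{E}^2$ is the span of all products. The attached directed graph $\Gamma(\mathcal{E},B)=(V,E)$ has $V=B$ and $E=\{(v_i,v_j)\mid\alpha_{ij}\neq0\}\subseteq V\times V$. $\mathrm{Der}(\mathcal{E})=\{\delta\in\mathrm{End}_{\mathbb{F}}(\mathcal{E})\mid\delta(xy)=\delta(x)y+x\delta(y)\ \forall x,y\in\mathcal{E}\}$, a Lie algebra under the commutator. For a directed graph $(V,E)$, a path is a sequence $\gamma=(v_0,e_1,v_1,\ldots,v_{n-1},e_n,v_n)$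 with $n\geq0$, $v_i\in V$, $e_i\in E$, and for each $i=1,\ldots,n$ either $e_i=(v_{i-1},v_i)$ or $e_i=(v_i,v_{i-1})$. It is a cycle if $v_0=v_n$. The balance $\mathrm{b}(\gamma)\in\mathbb{Z}$ is the number of $i$ for which $e_i$ is traversed in the right direction ($e_i=(v_{i-1},v_i)$; a loop $e_i=(v,v)$ is counted here) minus the number of $i$ for which $e_i$ is traversed in the wrong direction ($e_i=(v_i,v_{i-1})$ with $v_{i-1}\ne v_i$). The balance of a graph is $\mathrm{b}(\Gamma)=\gcd\{|\mathrm{b}(\gamma)|:\gamma\text{ a cycle in }\Gamma\}$. Connected components are those of the underlying undirected graph. *)

(* Defs.v *)
From HB Require Import structures.
From mathcomp Require Import all_boot all_order all_algebra all_fingroup.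
From mathcomp Require Import cyclic boolp.
From mathcomp Require classical_sets.

Set Implicit Arguments.
Unset Strict Implicit.
Unset Printing Implicit Defensive.

Import GRing.Theory.
Local Open Scope ring_scope.

(* Mirrors [prodv]: by bilinearity a vector basis suffices
   ([mem_alg_square], [alg_square_min]). *)
Definition alg_square (F : fieldType) (E : vectType F)
    (mul : {bilinear E -> E -> E}) : {vspace E} :=
  <<[seq mul x y | x <- vbasis {:E}, y <- vbasis {:E}]>>%VS.

Definition natural_basis (F : fieldType) (E : vectType F)
    (mul : {bilinear E -> E -> E}) (n : nat) (B : n.-tuple E) : Prop :=
  basis_of {:E} B /\
  (forall i j : 'I_n, i != j -> mul (tnth B i) (tnth B j) = 0).

Definition structure_constant (F : fieldType) (E : vectType F)
    (mul : {bilinear E -> E -> E}) (n : nat) (B : n.-tuple E)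
    (i j : 'I_n) : F :=
  coord B j (mul (tnth B i) (tnth B i)).

Definition derivation (F : fieldType) (E : vectType F)
    (mul : {bilinear E -> E -> E}) (d : 'End(E)) : Prop :=
  forall x y : E, d (mul x y) = mul (d x) y + mul x (d y).

Definition leibniz_defect (F : fieldType) (E : vectType F)
    (mul : {bilinear E -> E -> E}) (x y : E) (d : 'End(E)) : E :=
  d (mul x y) - (mul (d x) y + mul x (d y)).

(* The subspace of all derivations of [E] ([mem_Der]), cut out by the Leibniz
   rule on a vector basis. *)
Definition Der (F : fieldType) (E : vectType F)
    (mul : {bilinear E -> E -> E}) : {vspace 'End(E)} :=
  (\bigcap_(i < \dim {:E}) \bigcap_(j < \dim {:E})
     lker (linfun (leibniz_defect mul (tnth (vbasis {:E}) i)
                                      (tnth (vbasis {:E}) j))))%VS.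

Definition lie_bracket (F : fieldType) (E : vectType F)
    (d1 d2 : 'End(E)) : 'End(E) :=
  (d1 \o d2)%VF - (d2 \o d1)%VF.

Definition abelian_lie (F : fieldType) (E : vectType F)
    (L : {vspace 'End(E)}) : Prop :=
  forall d1 d2 : 'End(E), d1 \in L -> d2 \in L -> lie_bracket d1 d2 = 0.

Record digraph (T : finType) := Digraph {
  vertices : {set T};
  edges : {set T * T};
  edges_sub : edges \subset setX vertices vertices
}.

(* The path (v_0, e_1, v_1, ..., e_n, v_n) is encoded by v_0 together with the
   sequence of the pairs (e_i, v_i). *)
Fixpoint is_walk (T : finType) (G : digraph T) (v : T)
    (s : seq ((T * T) * T)) : bool :=
  (v \in vertices G) &&
  (if s is (e, w) :: s' then
     [&& e \in edges G, (e == (v, w)) || (e == (w, v)) & is_walk G w s']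
   else true).

Fixpoint walk_end (T : finType) (v : T) (s : seq ((T * T) * T)) : T :=
  if s is (_, w) :: s' then walk_end w s' else v.

Definition is_cycle (T : finType) (G : digraph T) (v : T)
    (s : seq ((T * T) * T)) : bool :=
  is_walk G v s && (walk_end v s == v).

(* A loop satisfies the first test, hence always counts +1. *)
Fixpoint walk_balance (T : finType) (v : T) (s : seq ((T * T) * T)) : int :=
  if s is (e, w) :: s' then
    (if e == (v, w) then 1 else -1) + walk_balance w s'
  else 0.

Definition is_gcd (S : nat -> Prop) (g : nat) : Prop :=
  (forall m : nat, S m -> (g %| m)%N) /\
  (forall d : nat, (forall m : nat, S m -> (d %| m)%N) -> (d %| g)%N).

(* The gcd of a possibly infinite set of naturals; it exists by [gcd_setP] and
   is 0 when no element of the set is positive. *)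
Definition gcd_set (S : nat -> Prop) : nat :=
  classical_sets.xget 0%N (is_gcd S).

Definition balance (T : finType) (G : digraph T) : nat :=
  gcd_set (fun m => exists (v : T) (s : seq ((T * T) * T)),
             is_cycle G v s /\ m = `|walk_balance v s|%N).

Definition adjacent (T : finType) (G : digraph T) : rel T :=
  fun x y => ((x, y) \in edges G) || ((y, x) \in edges G).

(* The vertex sets of the connected components. *)
Definition components (T : finType) (G : digraph T) : {set {set T}} :=
  [set [set y | connect (adjacent G) x y] | x in vertices G].

Definition induced (T : finType) (G : digraph T) (C : {set T}) : digraph T :=
  Digraph (subsetIr (edges G) (setX C C)).

Fact evolution_graph_sub (n : nat) (A : {set 'I_n * 'I_n}) :
  A \subset setX [set: 'I_n] [set: 'I_n].
Proof. by apply/subsetP => x _; rewrite !inE. Qed.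

(* The basis vector v_i is identified with its index i. *)
Definition evolution_graph (F : fieldType) (E : vectType F)
    (mul : {bilinear E -> E -> E}) (n : nat) (B : n.-tuple E) :
    digraph 'I_n :=
  Digraph (evolution_graph_sub
    [set ij : 'I_n * 'I_n | structure_constant mul B ij.1 ij.2 != 0]).

(* The default value 1 of [insubd] is unused for odd p ([order2P]). *)
Definition order2 (p : nat) : nat :=
  #[insubd (1%g : {unit 'Z_p}) (2%:R : 'Z_p)]%g.

Lemma mem_alg_square (F : fieldType) (E : vectType F)
    (mul : {bilinear E -> E -> E}) (x y : E) : mul x y \in alg_square mul.
Proof.
rewrite (coord_vbasis (memvf x)) (coord_vbasis (memvf y)).
rewrite linear_sumlz memv_suml // => i _; rewrite linear_sumr memv_suml // => j _.
rewrite linearZl_LR linearZr_LR /= !memvZ // memv_span //.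
by apply: allpairs_f; apply: mem_nth; rewrite size_tuple.
Qed.

Lemma alg_square_min (F : fieldType) (E : vectType F)
    (mul : {bilinear E -> E -> E}) (U : {vspace E}) :
  (forall x y : E, mul x y \in U) -> (alg_square mul <= U)%VS.
Proof. by move=> mulU; apply/span_subvP => _ /allpairsP[[x y] [_ _ ->]]. Qed.

Fact leibniz_defect_is_linear (F : fieldType) (E : vectType F)
    (mul : {bilinear E -> E -> E}) (x y : E) :
  linear (leibniz_defect mul x y).
Proof.
move=> a d1 d2; rewrite /leibniz_defect !(add_lfunE, scale_lfunE).
rewrite linearDl linearDr linearZl_LR linearZr_LR /= scalerBr scalerDr.
by rewrite [RHS]addrACA -opprD; congr (_ - _); rewrite addrACA.
Qed.

HB.instance Definition _ (F : fieldType) (E : vectType F)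
    (mul : {bilinear E -> E -> E}) (x y : E) :=
  GRing.isLinear.Build F 'End(E) E *:%R (leibniz_defect mul x y)
    (leibniz_defect_is_linear mul x y).

Lemma mem_Der (F : fieldType) (E : vectType F)
    (mul : {bilinear E -> E -> E}) (d : 'End(E)) :
  d \in Der mul <-> derivation mul d.
Proof.
split=> [dD x y | dD].
  have dB i j : leibniz_defect mul (tnth (vbasis {:E}) i)
                  (tnth (vbasis {:E}) j) d = 0.
    move: dD; rewrite memvE => /subv_bigcapP/(_ i isT)/subv_bigcapP/(_ j isT).
    by rewrite -memvE memv_ker lfunE /= => /eqP.
  have dBy i z : d (mul (vbasis {:E})`_i z) =
      mul (d (vbasis {:E})`_i) z + mul (vbasis {:E})`_i (d z).
    have [ltiE|geiE] := ltnP i (\dim {:E}); last first.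
      by rewrite nth_default ?size_tuple // !(linear0, linear0l) addr0.
    rewrite (coord_vbasis (memvf z)) !(linear_sumr, linear_sum) -big_split /=.
    apply: eq_bigr => j _; rewrite !(linearZr_LR, linearZ) /= -scalerDr.
    congr (_ *: _); have /eqP := dB (Ordinal ltiE) j.
    by rewrite subr_eq0 !(tnth_nth 0) => /eqP.
  rewrite (coord_vbasis (memvf x)) linear_sumlz !(linear_sum d) !linear_sumlz.
  rewrite -big_split /=; apply: eq_bigr => i _.
  by rewrite linearZl_LR !linearZ !linearZl_LR /= -scalerDr dBy.
rewrite memvE; apply/subv_bigcapP => i _; apply/subv_bigcapP => j _.
by rewrite -memvE memv_ker lfunE /= /leibniz_defect dD subrr.
Qed.

Lemma Der_bracket (F : fieldType) (E : vectType F)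
    (mul : {bilinear E -> E -> E}) (d1 d2 : 'End(E)) :
  d1 \in Der mul -> d2 \in Der mul -> lie_bracket d1 d2 \in Der mul.
Proof.
move=> /mem_Der D1 /mem_Der D2; apply/mem_Der => x y.
rewrite /lie_bracket !(add_lfunE, opp_lfunE, comp_lfunE) /=.
rewrite D2 D1 !(linearD d1) !(linearD d2) /= !D1 !D2.
rewrite linearBl linearBr.
rewrite [X in X - _](AC (2*2) ((1*4)*(2*3))) [X in _ - X](AC (2*2) ((1*4)*(3*2))).
by rewrite opprD addrACA subrr addr0 opprD addrACA.
Qed.

Lemma gcd_setP (S : nat -> Prop) : is_gcd S (gcd_set S).
Proof.
apply: classical_sets.xgetPex.
have [[s [Ss s_gt0]]|S0] := pselect (exists s, S s /\ (0 < s)%N); last first.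
  exists 0%N; split=> // m Sm; case: m Sm => // m Sm.
  by case: S0; exists m.+1.
pose cd d := `[< forall m, S m -> (d %| m)%N >].
exists (\big[lcmn/1%N]_(d < s.+1 | cd d) d)%N; split=> [m Sm | d dS].
  by apply/dvdn_biglcmP => d /asboolP; apply.
have ds : (d < s.+1)%N by rewrite ltnS dvdn_leq // dS.
by apply: (biglcmn_sup (Ordinal ds)) => //; apply/asboolP.
Qed.

Lemma order2P (p : nat) : prime p -> p != 2%N ->
  (order2 p).-primitive_root (2%:R : 'Z_p).
Proof.
move=> p_pr p_neq2; rewrite /order2; set u := insubd _ _.
have uE : val u = 2%:R.
  apply: insubdK; rewrite unfold_in -/(_ \is a GRing.unit) unitZpE ?prime_gt1 //.
  by rewrite prime_coprime // dvdn_prime2.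
rewrite -uE; apply/andP; split; first exact: order_gt0.
apply/forallP => i; apply/eqP; rewrite unity_rootE.
rewrite -FinRing.val_unitX -FinRing.val_unit1 (inj_eq val_inj) -order_dvdn.
apply/idP/eqP => [/(dvdn_leq (ltn0Sn i)) le_ui|->//].
by apply/eqP; rewrite eqn_leq le_ui ltn_ord.
Qed.

(* Main.v *)
Require Import Defs.
From HB Require Import structures.
From mathcomp Require Import all_boot all_order all_algebra all_fingroup.

Set Implicit Arguments.
Unset Strict Implicit.
Unset Printing Implicit Defensive.

Import GRing.Theory.
Local Open Scope ring_scope.

(* Since E^2 = E, the squares v_i^2 form a basis.  Applying a derivation d to
   v_i v_j = 0 gives d_ij v_j^2 + d_ji v_i^2 = 0, so d is diagonal, d v_i = u_i v_i,
   and applying it to v_i^2 shows that the derivations are exactly the diagonal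
   maps with u_j = 2 u_i along every edge (i, j).  As every vertex has an incoming
   edge, going backwards along edges gives (2^k - 2^m) u = 0 with m < k in
   characteristic 0, and u_j = 2 u_i = 0 in characteristic 2.  In odd
   characteristic u is multiplied by 2^b along a walk of balance b, so on a
   connected component u is determined by its value at one vertex, which is
   arbitrary if 2^b = 1 for every cycle and must be 0 otherwise. *)

(** * Walks and connected components of a digraph *)

Section Walks.
Variables (T : finType) (G : digraph T).
Implicit Types (C : {set T}) (s : seq ((T * T) * T)).

Definition component (x : T) : {set T} := [set y | connect (adjacent G) x y].

Lemma adjacent_connect_sym : connect_sym (adjacent G).
Proof. by apply: sym_connect_sym => x y; rewrite /adjacent orbC. Qed.

Lemma mem_component x : x \in component x.
Proof. by rewrite inE connect0. Qed.

Lemma componentP x y : reflect (component x = component y) (y \in component x).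
Proof.
apply: (iffP idP) => [|->]; last exact: mem_component.
rewrite inE => xy; apply/setP => z; rewrite !inE.
exact: (same_connect adjacent_connect_sym).
Qed.

Lemma components_eq C y : C \in components G -> y \in C -> C = component y.
Proof. by move=> /imsetP[x _ ->] /componentP. Qed.

Lemma component_closed x : closed (adjacent G) (mem (component x)).
Proof.
move=> y z /connect1 yz; rewrite /= !inE.
by rewrite !(adjacent_connect_sym x) (same_connect adjacent_connect_sym yz).
Qed.

Lemma walk_cat v s t :
  is_walk G v s -> is_walk G (walk_end v s) t -> is_walk G v (s ++ t).
Proof.
elim: s v => [|[e w] s IHs] v //= /andP[-> /and3P[-> -> sw]] /= tw.
exact: IHs.
Qed.

Lemma walk_end_cat v s t : walk_end v (s ++ t) = walk_end (walk_end v s) t.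
Proof. by elim: s v => [|[e w] s IHs] v /=. Qed.

Lemma walk_balance_cat v s t :
  walk_balance v (s ++ t) = walk_balance v s + walk_balance (walk_end v s) t.
Proof. by elim: s v => [|[e w] s IHs] v /=; rewrite ?add0r // IHs addrA. Qed.

(** The balance is taken on single components, so walks are needed inside the induced graph;
    closedness of [C] keeps each successive vertex in [C]. *)
Lemma connect_walk C x y :
    closed (adjacent G) (mem C) -> x \in C -> connect (adjacent G) x y ->
  exists2 s, is_walk (induced G C) x s & walk_end x s = y.
Proof.
move=> clC Cx /connectP[p]; elim: p x Cx => [|z p IHp] x Cx /=.
  by move=> _ ->; exists [::]; rewrite //= Cx.
case/andP=> xz zp yE; have Cz : z \in C by have := clC _ _ xz; rewrite Cx.
have [s sw sE] := IHp z Cz zp yE; case/orP: xz => xz.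
  exists (((x, z), z) :: s) => //=.
  by rewrite !inE /= Cx Cz xz eqxx sw.
exists (((z, x), z) :: s) => //=.
by rewrite !inE /= Cx Cz xz eqxx orbT sw.
Qed.

End Walks.

(** * Vertex functions multiplied by a fixed scalar along every edge *)

Section Potentials.
Variables (F : fieldType) (a : F) (T : finType).
Hypothesis a_neq0 : a != 0.
Implicit Types (G : digraph T) (C : {set T}) (u w : T -> F).
Implicit Types (x y v : T) (s t : seq ((T * T) * T)).

(** For [a] = 2 these are the eigenvalue families of the diagonal derivations. *)
Definition potential G u : Prop :=
  forall i j, (i, j) \in edges G -> u j = a * u i.

Definition cycles_trivial G : Prop :=
  forall v s, is_cycle G v s -> a ^ walk_balance v s = 1.

Lemma potential_walk G u v s : potential G u -> is_walk G v s ->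
  u (walk_end v s) = a ^ walk_balance v s * u v.
Proof.
move=> uG; elim: s v => [|[e w] s IHs] v /=; first by rewrite expr0z mul1r.
case/andP=> _ /and3P[eG ew sw]; rewrite (IHs _ sw) addrC expfzDr // -mulrA.
congr (_ * _); case: eqP eG ew => [-> eG _|_ eG /= /eqP ew].
  by rewrite expr1z (uG _ _ eG).
by rewrite (uG w v) ?mulKf // -ew.
Qed.

Lemma potential_induced G C u : potential G u -> potential (induced G C) u.
Proof. by move=> uG i j; rewrite inE => /andP[/uG]. Qed.

Lemma potential_component G u x y : potential G u -> y \in component G x ->
  exists s, u y = a ^ walk_balance x s * u x.
Proof.
move=> uG; rewrite inE => xy.
have [s sw sE] := connect_walk (@component_closed T G x) (mem_component G x) xy.
by exists s; rewrite -sE; apply: potential_walk sw; apply: potential_induced.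
Qed.

(** A walk from [x] multiplies both functions by the same power of [a], so their ratio stays equal
    to the one at [x]. *)
Lemma potential_proportional G u w x : potential G u -> potential G w ->
  u x != 0 -> exists c, forall y, y \in component G x -> w y = c * u y.
Proof.
move=> uG wG ux; exists (w x / u x) => y; rewrite inE => xy.
have [s sw <-] := connect_walk (@component_closed T G x) (mem_component G x) xy.
rewrite !(potential_walk _ sw); try exact: potential_induced.
by rewrite mulrCA divfK.
Qed.

(** Going round a cycle of balance b multiplies the value by [a] ^ b yet returns to the same nonzero
    value. *)
Lemma potential_neq0_cycles G u x : potential G u -> u x != 0 ->
  cycles_trivial (induced G (component G x)).
Proof.
move=> uG ux v s /andP[sw /eqP sE].
have vx : v \in component G x by case: s sw {sE} => [|[e w] s] /andP[].
have [t uv] := potential_component uG vx.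
have uv_neq0 : u v != 0 by rewrite uv mulf_neq0 ?expfz_neq0.
have := potential_walk (potential_induced uG) sw; rewrite sE => uvE.
by apply: (mulIf uv_neq0); rewrite -uvE mul1r.
Qed.

(* Walks are never reversed, since a loop counts +1 in both directions: closing
   up [s] and [t] by the same return walk suffices. *)
Lemma walk_balance_unique G C x s t :
    closed (adjacent G) (mem C) -> cycles_trivial (induced G C) ->
    is_walk (induced G C) x s -> is_walk (induced G C) x t ->
    walk_end x s = walk_end x t -> connect (adjacent G) x (walk_end x s) ->
  a ^ walk_balance x s = a ^ walk_balance x t.
Proof.
move=> clC trivC sw tw st xs.
have Cx : x \in C by case: s sw {st xs} => [|[e w] s] /andP[].
have Cy : walk_end x s \in C by rewrite -(closed_connect clC xs).
have yx : connect (adjacent G) (walk_end x s) x by rewrite adjacent_connect_sym.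
have [r rw rE] := connect_walk clC Cy yx.
have closeE q : is_walk (induced G C) x q -> walk_end x q = walk_end x s ->
    a ^ walk_balance x q * a ^ walk_balance (walk_end x s) r = 1.
  move=> qw qs; rewrite -expfzDr // -qs -walk_balance_cat; apply: trivC.
  by rewrite /is_cycle walk_cat ?qs // walk_end_cat qs rE eqxx.
apply: (mulIf (expfz_neq0 (walk_balance (walk_end x s) r) a_neq0)).
by rewrite !closeE.
Qed.

(** Each component selected by [g] gets the value 1 or a power of [a] at every vertex: the exponent
    is the balance of a chosen walk from the root. Trivial cycles make this independent of the walk;
    all other components get 0. *)
Lemma exists_potential G (g : pred {set T}) :
    (forall C, g C -> cycles_trivial (induced G C)) ->
  exists2 u, potential G u & forall x, (u x != 0) = g (component G x).
Proof.
move=> trivg; pose r := fingraph.root (adjacent G).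
have rE x : component G (r x) = component G x.
  by apply/componentP; rewrite inE adjacent_connect_sym connect_root.
have /fin_all_exists2[f fw fE] x : exists2 s,
    is_walk (induced G (component G x)) (r x) s & walk_end (r x) s = x.
  apply: connect_walk; first exact: component_closed.
    by rewrite inE connect_root.
  by rewrite adjacent_connect_sym connect_root.
exists (fun x => if g (component G x) then a ^ walk_balance (r x) (f x) else 0).
  move=> i j ij; have ij1 : adjacent G i j by rewrite /adjacent ij.
  have cE : component G i = component G j.
    by apply/componentP; rewrite inE connect1.
  have rij : r i = r j by apply/(fingraph.rootP (@adjacent_connect_sym _ G))/connect1.
  rewrite cE; case: ifP => [gj|]; last by rewrite mulr0.
  have fiw := fw i; rewrite cE rij in fiw; have fiE := fE i; rewrite rij in fiE.
  have iC : i \in component G j by rewrite -cE mem_component.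
  have jC := mem_component G j.
  rewrite rij -[X in _ = X * _]expr1z -expfzDr // addrC.
  (* The walk chosen for [i], prolonged by the edge ([i], [j]), competes with the walk chosen for
     [j]. *)
  have -> : walk_balance (r j) (f i) + 1 =
            walk_balance (r j) (f i ++ [:: ((i, j), j)]).
    by rewrite walk_balance_cat /= fiE eqxx addr0.
  apply: (walk_balance_unique (@component_closed _ G j) (trivg _ gj)).
  - exact: fw.
  - apply: walk_cat; rewrite // fiE /= iC !inE /= ij eqxx /=.
    by rewrite -![connect _ j _]in_set -/(component G j) iC jC.
  - by rewrite walk_end_cat fE.
  - by rewrite fE adjacent_connect_sym connect_root.
move=> x; case: ifP; first by rewrite expfz_neq0.
by rewrite eqxx.
Qed.

(** Iterating a choice [f] of predecessors in a finite set must revisit a vertex, which yields two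
    expressions of [u j] with distinct powers of [a] and the same vertex value. *)
Lemma potential_eq0_of_in_edges G u :
    (forall m k, (m < k)%N -> a ^+ m != a ^+ k) ->
    (forall j, exists i, (i, j) \in edges G) ->
  potential G u -> forall j, u j = 0.
Proof.
move=> a_inf /fin_all_exists[f fP] uG j.
have uf k : u j = a ^+ k * u (iter k f j).
  elim: k => [|k ->]; first by rewrite mul1r.
  by rewrite exprSr -mulrA /= -(uG _ _ (fP _)).
have /trajectP[m m_lt mE] := looping_order f j.
have := uf (fingraph.order f j); rewrite mE (uf m) => /eqP.
rewrite -subr_eq0 -mulrBl mulf_eq0 subr_eq0 (negPf (a_inf _ _ m_lt)) /=.
by move/eqP->; rewrite mulr0.
Qed.

End Potentials.

(** * Divisibility of the balance by the order of 2 *)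

Lemma dvdn_balance (T : finType) (G : digraph T) (d : nat) :
  (d %| balance G)%N <->
  forall v s, is_cycle G v s -> (d %| `|walk_balance v s|)%N.
Proof.
have [gcdP gcd_max] := gcd_setP (fun m => exists (v : T) s,
  is_cycle G v s /\ m = `|walk_balance v s|%N).
split=> [dG v s vs | dG]; last by apply: gcd_max => _ [v [s [vs ->]]]; apply: dG.
by apply: dvdn_trans dG _; apply: gcdP; exists v, s.
Qed.

Lemma order2_dvd_exprz (F : fieldType) (p : nat) (b : int) :
    p \in [pchar F] -> p != 2%N ->
  (order2 p %| `|b|)%N = ((2%:R : F) ^ b == 1).
Proof.
move=> pF p2; have p_pr := pcharf_prime pF.
have natE (k : nat) : (order2 p %| k)%N = ((2%:R : F) ^+ k == 1).
  have pZ : p \in [pchar 'Z_p].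
    by rewrite inE p_pr pchar_Zp ?prime_gt1 /=.
  (* In every ring of characteristic [p] the equation 2 ^ k = 1 means the same divisibility of
     integers, which transfers it from ['Z_p] to [F]. *)
  have subE (R : nzRingType) : p \in [pchar R] ->
      ((2%:R : R) ^+ k == 1) = (p %| 2 ^ k - 1)%N.
    move=> pR; rewrite (dvdn_pcharf pR) natrB ?expn_gt0 // natrX.
    by rewrite subr_eq0.
  by rewrite (prim_order_dvd (order2P p_pr p2)) !subE.
case: b => k; first by rewrite natE.
by rewrite natE NegzE -exprnN invr_eq1.
Qed.

Lemma order2_dvd_balance (F : fieldType) (p : nat) (T : finType)
    (G : digraph T) : p \in [pchar F] -> p != 2%N ->
  (order2 p %| balance G)%N <-> cycles_trivial (2%:R : F) G.
Proof.
move=> pF p2; rewrite dvdn_balance; split=> H v s /H.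
  by rewrite (order2_dvd_exprz _ pF) // => /eqP.
by move/eqP; rewrite -(order2_dvd_exprz _ pF).
Qed.

(** * Endomorphisms diagonal in a given basis *)

Section DiagonalEndomorphisms.
Variables (F : fieldType) (E : vectType F) (n : nat) (B : n.-tuple E).
Hypothesis basisB : basis_of {:E} B.
Implicit Types (u w : 'I_n -> F) (d : 'End(E)).

Definition diag_end u : 'End(E) :=
  linfun (sval (linear_of_free B [tuple u i *: tnth B i | i < n])).

Lemma coord_tnth_basis x : x = \sum_i coord B i x *: tnth B i.
Proof.
rewrite {1}(coord_basis basisB (memvf x)).
by apply: eq_bigr => i _; rewrite (tnth_nth 0).
Qed.

Lemma coord_tnth i j : coord B i (tnth B j) = (i == j)%:R.
Proof. by rewrite (tnth_nth 0) coord_free ?(basis_free basisB) // eq_sym. Qed.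

Lemma diag_endE u i : diag_end u (tnth B i) = u i *: tnth B i.
Proof.
rewrite lfunE /sval; case: (linear_of_free _ _) => f /(_ (basis_free basisB)).
rewrite !size_tuple => /(_ erefl) /(congr1 (fun s => nth 0 s i)).
by rewrite (nth_map 0) ?size_tuple // -!tnth_nth tnth_mktuple.
Qed.

Lemma end_eq_basis d1 d2 :
  (forall i, d1 (tnth B i) = d2 (tnth B i)) -> d1 = d2.
Proof.
move=> dE; apply/lfunP => x; rewrite (coord_tnth_basis x) !linear_sum.
by apply: eq_bigr => i _; rewrite !linearZ /= dE.
Qed.

Lemma coord_diag_end u i x : coord B i (diag_end u x) = u i * coord B i x.
Proof.
rewrite {1}(coord_tnth_basis x) !linear_sum (bigD1 i) //= big1 => [|j ji].
  by rewrite !linearZ /= diag_endE !linearZ /= coord_tnth eqxx addr0 mulr1 mulrC.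
by rewrite !linearZ /= diag_endE !linearZ /= coord_tnth eq_sym (negPf ji) !mulr0.
Qed.

Lemma diag_end_bracket u w : lie_bracket (diag_end u) (diag_end w) = 0.
Proof.
apply: end_eq_basis => i; rewrite /lie_bracket !(add_lfunE, opp_lfunE).
rewrite !comp_lfunE !diag_endE !linearZ /= !diag_endE !scalerN !scalerA.
by rewrite mulrC subrr zero_lfunE.
Qed.

End DiagonalEndomorphisms.

(** * Derivations of an evolution algebra *)

Section EvolutionAlgebra.
Variables (F : fieldType) (E : vectType F) (mul : {bilinear E -> E -> E}).
Variables (n : nat) (B : n.-tuple E).
Hypothesis natB : natural_basis mul B.

Let basisB : basis_of {:E} B := natB.1.
Let G := evolution_graph mul B.
Let sq (i : 'I_n) := mul (tnth B i) (tnth B i).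

Lemma mem_evolution_edges i j : ((i, j) \in edges G) = (coord B j (sq i) != 0).
Proof. by rewrite inE. Qed.

Lemma evolution_mul_coord x y :
  mul x y = \sum_i (coord B i x * coord B i y) *: sq i.
Proof.
rewrite {1}(coord_tnth_basis basisB x) linear_sumlz; apply: eq_bigr => i _.
rewrite linearZl_LR /= {1}(coord_tnth_basis basisB y) linear_sumr (bigD1 i) //=.
rewrite big1 ?addr0 => [|j ji]; rewrite linearZr_LR /=.
  by rewrite scalerA.
by rewrite natB.2 ?scaler0 // eq_sym.
Qed.

Lemma diag_end_derivation u :
  potential 2%:R G u -> derivation mul (diag_end B u).
Proof.
move=> uG x y; rewrite !evolution_mul_coord linear_sum -big_split /=.
apply: eq_bigr => i _; rewrite !(coord_diag_end basisB) linearZ -scalerDl /=.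
(* All basis vectors occurring in [sq i] are heads of edges from [i], hence share the eigenvalue 2
   [u i]. *)
have -> : diag_end B u (sq i) = (2%:R * u i) *: sq i.
  rewrite (coord_tnth_basis basisB (sq i)) linear_sum scaler_sumr.
  apply: eq_bigr => j _; rewrite linearZ /= (diag_endE basisB) !scalerA /=.
  have [->|ij] := eqVneq (coord B j (sq i)) 0; first by rewrite mul0r mulr0.
  by rewrite (uG i) ?mem_evolution_edges // mulrC.
rewrite scalerA mulr_natl mulr2n mulrDr; congr ((_ + _) *: _).
  by rewrite mulrC mulrA.
by rewrite mulrAC mulrA.
Qed.

Hypothesis perfectE : alg_square mul = fullv.

Lemma span_squares : <<[tuple sq i | i < n]>>%VS = fullv.
Proof.
apply/eqP; rewrite eqEsubv subvf -perfectE; apply/alg_square_min => x y.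
rewrite evolution_mul_coord memv_suml // => i _; rewrite memvZ // memv_span //.
by rewrite map_f ?mem_enum.
Qed.

Lemma free_squares : free [tuple sq i | i < n].
Proof.
by rewrite /free span_squares size_tuple -(size_basis basisB).
Qed.

(** Otherwise the [j]-th coordinate would vanish on all squares, hence on their span, which is
    everything. *)
Lemma evolution_in_edge j : exists i, (i, j) \in edges G.
Proof.
apply/existsP; apply/contraT; rewrite negb_exists => /forallP no_edge.
have Bj : tnth B j \in <<[tuple sq i | i < n]>>%VS by rewrite span_squares memvf.
have := coord_tnth basisB j j; rewrite (coord_span Bj) linear_sum big1 => [|i _].
  by move/eqP; rewrite eqxx eq_sym oner_eq0.
rewrite linearZ -tnth_nth tnth_mktuple /=; have := no_edge i.
by rewrite mem_evolution_edges negbK => /eqP->; rewrite mulr0.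
Qed.

Lemma derivation_diag_end d : derivation mul d ->
  exists2 u, potential 2%:R G u & d = diag_end B u.
Proof.
move=> dD; pose c i j := coord B j (d (tnth B i)).
have mull i x : mul (tnth B i) x = coord B i x *: sq i.
  rewrite evolution_mul_coord (bigD1 i) //= big1 => [|j ji].
    by rewrite (coord_tnth basisB) eqxx mul1r addr0.
  by rewrite (coord_tnth basisB) (negPf ji) mul0r scale0r.
have mulr i x : mul x (tnth B i) = coord B i x *: sq i.
  rewrite -mull !evolution_mul_coord.
  by apply: eq_bigr => j _; rewrite [_ * coord _ _ x]mulrC.
have c0 i j : i != j -> c i j = 0.
  move=> ij; have := dD (tnth B i) (tnth B j).
  rewrite natB.2 // linear0 mull mulr -/(c i j) -/(c j i) => /esym cE.
  (* The relation in [cE] is a linear relation between the two squares [sq i] and [sq j]; freeness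
     is read off at index [j], whose coefficient is [c i j]. *)
  have /freeP/(_ (fun k => if k == i then c j i else
                  if k == j then c i j else 0)) := free_squares.
  move=> /(_ _ j); rewrite eqxx [j == i]eq_sym (negPf ij); apply.
  rewrite (bigD1 i) // (bigD1 j) 1?eq_sym // big1 => [|k /andP[/negPf-> /negPf->]].
    by rewrite !eqxx eq_sym (negPf ij) -!tnth_nth !tnth_mktuple /= addr0 addrC.
  by rewrite scale0r.
have dE i : d (tnth B i) = c i i *: tnth B i.
  rewrite (coord_tnth_basis basisB (d _)) (bigD1 i) //= big1 ?addr0 // => j ji.
  by rewrite -/(c i j) c0 ?scale0r // eq_sym.
have dE' : d = diag_end B (fun i => c i i).
  by apply: (end_eq_basis basisB) => i; rewrite (diag_endE basisB).
exists (fun i => c i i) => // i j; rewrite mem_evolution_edges => ij.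
(* Comparing [j]-th coordinates in d(v_i^2) = 2 u_i v_i^2, the nonzero structure constant
   cancels. *)
have := congr1 (coord B j) (dD (tnth B i) (tnth B i)).
rewrite (mull i (d _)) (mulr i (d _)) -/(c i i) -scalerDl -mulr2n linearZ /=.
by rewrite [in LHS]dE' (coord_diag_end basisB) => /(mulIf ij) ->; rewrite mulr_natl.
Qed.

Lemma Der_eq0 :
  (forall u, potential (2%:R : F) G u -> forall i, u i = 0) -> Der mul = 0%VS.
Proof.
move=> u0; apply/eqP; rewrite -subv0; apply/subvP => d /mem_Der.
move=> /derivation_diag_end[u /u0{}u0 ->]; rewrite memv0; apply/eqP.
apply: (end_eq_basis basisB) => i.
by rewrite (diag_endE basisB) u0 scale0r zero_lfunE.
Qed.

Lemma Der_abelian : abelian_lie (Der mul).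
Proof.
move=> d1 d2 /mem_Der/derivation_diag_end[u1 _ ->].
move=> /mem_Der/derivation_diag_end[u2 _ ->].
exact: diag_end_bracket.
Qed.

(** A single potential [u], nonzero exactly on the components in [S], is cut down to each of them;
    the resulting diagonal maps form a basis of the derivations. *)
Lemma dim_Der (S : {set {set 'I_n}}) : (2%:R : F) != 0 ->
    S \subset components G ->
    (forall C, C \in components G ->
       C \in S <-> cycles_trivial (2%:R : F) (induced G C)) ->
  \dim (Der mul) = #|S|.
Proof.
move=> two_neq0 /subsetP S_comp S_triv.
have compG x : component G x \in components G by apply: imset_f; rewrite inE.
have [u uG u_neq0] := exists_potential two_neq0
  (fun C SC => (S_triv C (S_comp C SC)).1 SC).
pose uC (C : {set 'I_n}) i := if i \in C then u i else 0.
have uCG C : C \in components G -> potential 2%:R G (uC C).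
  case/imsetP=> x _ -> i j ij.
  have := @component_closed _ G x i j; rewrite /adjacent ij /uC => /(_ isT) /= ->.
  by case: ifP => _; rewrite ?mulr0 // (uG _ _ ij).
have uCE C i : C \in S -> uC C i = if component G i == C then u i else 0.
  move=> /S_comp CG; rewrite /uC; congr (if _ then _ else _).
  apply/idP/eqP => [iC | <-]; last exact: mem_component.
  by rewrite (components_eq CG iC).
pose X := [tuple diag_end B (uC (enum_val k)) | k < #|S|].
(* Only the summand of the component of [i] acts on the [i]-th basis vector. Outside [S] both sides
   vanish because [u i] = 0. *)
have sumXE (c : {set 'I_n} -> F) i :
    (\sum_(k < #|S|) c (enum_val k) *: X`_k) (tnth B i) =
    (c (component G i) * u i) *: tnth B i.
  rewrite sum_lfunE (eq_bigr (fun k => (fun C => (c C * uC C i) *: tnth B i)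
                       (enum_val k))); last first.
    move=> k _; rewrite -tnth_nth tnth_mktuple scale_lfunE (diag_endE basisB).
    by rewrite scalerA.
  rewrite -(big_enum_val (fun C => (c C * uC C i) *: tnth B i)) /=.
  have [iS|iNS] := boolP (component G i \in S).
    rewrite (bigD1 (component G i)) //= big1 ?addr0 => [|C /andP[CS Ci]].
      by rewrite uCE // eqxx.
    by rewrite uCE // eq_sym (negPf Ci) mulr0 scale0r.
  have /negbFE/eqP-> : (u i != 0) = false by rewrite u_neq0 (negPf iNS).
  rewrite mulr0 scale0r big1 // => C CS; rewrite uCE //.
  by case: eqP => [CE|_]; rewrite ?mulr0 ?scale0r //; rewrite -CE in CS;
    rewrite CS in iNS.
have freeX : free X.
  apply/freeP => k kX0 i; have CS := enum_valP i.
  have /imsetP[x _ Cx] := S_comp _ CS; rewrite -/(component G x) in Cx.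
  (* The coefficients are reindexed by components to fit [sumXE]; evaluating at the vertex [x] of
     the [i]-th component then isolates [k i]. *)
  pose c C := if C \in S then k (enum_rank_in CS C) else 0.
  have cE j : c (enum_val j) = k j by rewrite /c enum_valP enum_valK_in.
  have := sumXE c x; under eq_bigr do rewrite cE.
  rewrite kX0 zero_lfunE -Cx cE => /esym/eqP.
  rewrite scaler_eq0 mulf_eq0 => /orP[/orP[/eqP//|]|].
    by rewrite -[_ == 0]negbK u_neq0 -Cx CS.
  move/eqP=> Bx; have := coord_tnth basisB x x.
  by rewrite Bx linear0 eqxx => /esym/eqP; rewrite oner_eq0.
suff -> : Der mul = <<X>>%VS by move: freeX => /eqP->; rewrite size_tuple.
apply/eqP; rewrite eqEsubv; apply/andP; split; last first.
  apply/span_subvP => _ /tnthP[k ->]; rewrite tnth_mktuple.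
  by apply/mem_Der/diag_end_derivation/uCG/S_comp/enum_valP.
apply/subvP => d /mem_Der/derivation_diag_end[w wG ->].
have /fin_all_exists[c cP] (C : {set 'I_n}) : exists c : F,
    C \in S -> forall i, i \in C -> w i = c * u i.
  have [CS|] := boolP (C \in S); last by exists 0.
  have /imsetP[x _ Cx] := S_comp _ CS; rewrite -/(component G x) in Cx.
  have [|c cP] := potential_proportional two_neq0 uG wG (x := x).
    by rewrite u_neq0 -Cx.
  by exists c => _ i; rewrite Cx; apply: cP.
have -> : diag_end B w = \sum_(k < #|S|) c (enum_val k) *: X`_k.
  apply: (end_eq_basis basisB) => i; rewrite sumXE (diag_endE basisB).
  congr (_ *: _); have [iS|iNS] := boolP (component G i \in S).
    by apply: cP => //; apply: mem_component.
  have /negbFE/eqP-> : (u i != 0) = false by rewrite u_neq0 (negPf iNS).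
  (* A nonzero value of [w] at [i] would make the cycles of its component trivial and so put that
     component in [S]. *)
  rewrite mulr0; apply/eqP; apply: contraNT iNS => wi.
  by apply/S_triv => //; apply: potential_neq0_cycles wG wi.
apply: memv_suml => k _; rewrite memvZ // memv_span // mem_nth //.
by rewrite size_tuple.
Qed.

End EvolutionAlgebra.

Theorem theorem4p1 (F : fieldType) (E : vectType F)
    (mul : {bilinear E -> E -> E}) (n : nat) (B : n.-tuple E)
    (natB : natural_basis mul B)
    (perfectE : alg_square mul = fullv) :
  ([pchar F] =i pred0 \/ 2%N \in [pchar F] -> Der mul = 0%VS) /\
  (forall p : nat, p \in [pchar F] -> p != 2%N ->
     abelian_lie (Der mul) /\
     \dim (Der mul) =
       #|[set C in components (evolution_graph mul B) |
            (order2 p %| balance (induced (evolution_graph mul B) C))%N]|).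
Proof.
have in_edge := evolution_in_edge natB perfectE.
split=> [charF | p pF p_neq2].
  apply: (Der_eq0 natB perfectE) => u uG; case: charF => [char0 | char2].
    apply: potential_eq0_of_in_edges uG => // m k mk.
    (* Equal powers would annihilate the positive integer 2 ^ k - 2 ^ m in characteristic 0. *)
    rewrite -!natrX eq_sym -subr_eq0 -natrB ?leq_exp2l ?(ltnW mk) //.
    by rewrite ((pcharf0P _).1 char0) subn_eq0 leq_exp2l // -ltnNge.
  by move=> j; have [i /uG->] := in_edge j; rewrite (pcharf0 char2) mul0r.
split; first exact: (Der_abelian natB perfectE).
apply: (dim_Der natB perfectE) => [||C CG].
- rewrite -(dvdn_pcharf pF) dvdn_prime2 ?(pcharf_prime pF) //.
- by apply/subsetP => C; rewrite inE => /andP[].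
- by rewrite inE CG /=; apply: order2_dvd_balance.
Qed.
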